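(* Let $A\in\mathbb{C}^{n\times n}$, let $B=B^H\in\mathbb{C}^{n\times n}$ be Hermitian positive definite with upper triangular Cholesky factor $R$ (so $B=R^HR$), and let $\theta>0$ be a real scalar. If $A^HA-\theta B^2$ and $AA^H-\theta B^2$ are both positive definite, then $$\sigma_{\min}(R^{-H}AR^{-1})\geq\sqrt{\theta}.$$
   Context: $M^H$ is the conjugate transpose of $M$, $R^{-H}=(R^H)^{-1}$, and $\sigma_{\min}(M)$ denotes the smallest singular value of a square matrix $M$. *)

(* Defs.v *)
From mathcomp Require Export all_boot all_order all_algebra.
From mathcomp Require Export sesquilinear spectral.
From mathcomp Require Export complex.
From mathcomp Require Export classical_sets reals.

Set Implicit Arguments.
Unset Strict Implicit.
Unset Printing Implicit Defensive.

Import Order.TTheory GRing.Theory Num.Theory.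

Local Open Scope ring_scope.
Local Open Scope complex_scope.
Local Open Scope sesquilinear_scope.

(* The order of a numClosedFieldType is partial: [0 < z] says that [z] is real
   and positive. *)
Definition posdefmx (C : numClosedFieldType) (n : nat) (M : 'M[C]_n) : Prop :=
  M \is hermsymmx /\
  forall x : 'cV[C]_n, x != 0 -> 0 < (x ^t* *m M *m x) 0 0.

(* [is_trig_mx] means lower triangular, hence the transpose. The positive
   diagonal is the usual normalization making the factor unique. *)
Definition cholesky_factor (C : numClosedFieldType) (n : nat)
    (B R : 'M[C]_n) : Prop :=
  [/\ is_trig_mx R^T, forall i, 0 < R i i & B = R ^t* *m R].

Definition singular_value (K : realType) (n : nat) (M : 'M[K[i]]_n) (s : K) :
    bool :=
  (0 <= s) && eigenvalue (M ^t* *m M) (s ^+ 2)%:C.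

(* For [0 < n] this infimum is a minimum, see [sigma_minP]; for [n = 0] there
   is no singular value and the value is the junk [inf set0 = 0]. *)
Definition sigma_min (K : realType) (n : nat) (M : 'M[K[i]]_n) : K :=
  inf [set s | singular_value M s]%classic.

Lemma eigenvalue_gram_ge0 (C : numClosedFieldType) (n : nat) (M : 'M[C]_n) a :
  eigenvalue (M ^t* *m M) a -> 0 <= a.
Proof.
move=> /eigenvalueP[v vM v0].
have v_gt0 : 0 < dotmx v v by exact: dotmx_is_dotmx.
have: 0 <= dotmx (v *m M ^t*) (v *m M ^t*).
  have [->|w0] := eqVneq (v *m M ^t*) 0; last exact/ltW/dotmx_is_dotmx.
  by rewrite dotmxE mul0mx mxE.
rewrite dotmxE trmx_mul map_mxM trmxCK mulmxA -(mulmxA v) vM -scalemxAl mxE.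
by rewrite -dotmxE pmulr_lge0.
Qed.

Lemma sigma_minP (K : realType) (n : nat) (M : 'M[K[i]]_n) : (0 < n)%N ->
  singular_value M (sigma_min M) /\
  forall s, singular_value M s -> sigma_min M <= s.
Proof.
move=> n_gt0; set S := [set s | singular_value M s]%classic.
have [rs rsE] := closed_field_poly_normal (char_poly (M ^t* *m M)).
have rsP a : eigenvalue (M ^t* *m M) a = (a \in rs).
  rewrite eigenvalue_root_char rsE rootZ ?root_prod_XsubC//.
  by rewrite lead_coef_eq0 -size_poly_eq0 size_char_poly.
pose ss := [seq Num.sqrt (complex.Re a) | a <- rs].
have ssP s : singular_value M s = (s \in ss).
  apply/idP/mapP => [/andP[s0 es]|[a ars ->]].
    by exists (s ^+ 2)%:C; [rewrite -rsP|rewrite /= sqrtr_sqr ger0_norm].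
  have ea : eigenvalue (M ^t* *m M) a by rewrite rsP.
  rewrite /singular_value sqrtr_ge0.
  have := eigenvalue_gram_ge0 ea; case: a {ars} ea => x y ea.
  rewrite lecE => /andP[/eqP/= y0 /= x0].
  by rewrite y0 in ea; rewrite (sqr_sqrtr x0).
have ss_min (t : seq K) : t != [::] ->
    exists2 m, m \in t & forall s, s \in t -> m <= s.
  elim: t => // x [|y t] IH _.
    by exists x => [|s]; rewrite inE // => /eqP->.
  have [//|m mt mP] := IH; exists (Num.min x m).
    by rewrite minEle; case: ifP => _; rewrite inE ?eqxx // mt orbT.
  by move=> s; rewrite inE ge_min => /predU1P[->|/mP->]; rewrite ?lexx ?orbT.
have [|m mss mP] := ss_min ss.
  have [a] := eigenvalue_closed (M ^t* *m M) n_gt0.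
  by rewrite rsP /ss; case: (rs).
suff -> : sigma_min M = m by split=> [|s]; rewrite ssP // => /mP.
have mlb : lbound S m by move=> s; rewrite /S /= ssP => /mP.
have Sm : S m by rewrite /S /= ssP.
apply/eqP; rewrite eq_le; apply/andP; split.
  by apply: ge_inf => //; exists m.
by apply: lb_le_inf => //; exists m.
Qed.

(* Main.v *)
Require Import Defs.

Set Implicit Arguments.
Unset Strict Implicit.
Unset Printing Implicit Defensive.

Import Order.TTheory GRing.Theory Num.Theory.
Local Open Scope ring_scope.
Local Open Scope complex_scope.
Local Open Scope sesquilinear_scope.

(** Put [M = R^-H A R^-1], so that [A = R^H M R], and let [u] be an eigenvector
    of [M^H M] for [a].  The vectors [y = R^-1 u] and [w = R^-1 M u] satisfy
      [A y = B w]  and  [A^H w = a B y],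
    because [B = R^H R].  The two hypotheses, evaluated at [y] and [w], give
      [|B w|^2 = |A y|^2 > theta |B y|^2],
      [a^2 |B y|^2 = |A^H w|^2 >= theta |B w|^2],
    hence [a^2 |B y|^2 > theta^2 |B y|^2] and [theta < a].  Every eigenvalue of
    the Gram matrix therefore exceeds [theta] ([eigenvalue_gram_gt]), and the
    square of [sigma_min M] is such an eigenvalue.  This is the eigenvector
    form of the norm estimate
      [|M^-1|^2 = rho(A^-1 B A^-H B) <= |A^-1 B| |B A^-1| <= 1 / theta],
    whose two factors are controlled by one hypothesis each. *)

Lemma adjmxZ (C : numClosedFieldType) (m n : nat) (a : C) (M : 'M[C]_(m, n)) :
  0 <= a -> (a *: M) ^t* = a *: M ^t*.
Proof. by move=> a0; apply/matrixP=> i j; rewrite !mxE rmorphM /= (geC0_conj a0). Qed.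

Definition sqnorm (C : numClosedFieldType) (n : nat) (x : 'cV[C]_n) : C :=
  (x ^t* *m x) 0 0.

Lemma sqnorm_ge0 (C : numClosedFieldType) (n : nat) (x : 'cV[C]_n) :
  0 <= sqnorm x.
Proof.
rewrite /sqnorm mxE sumr_ge0// => i _.
by rewrite !mxE mulrC mul_conjC_ge0.
Qed.

Lemma sqnorm0 (C : numClosedFieldType) (n : nat) :
  sqnorm (0 : 'cV[C]_n) = 0.
Proof. by rewrite /sqnorm mulmx0 mxE. Qed.

Lemma sqnormZ (C : numClosedFieldType) (n : nat) (a : C) (x : 'cV[C]_n) :
  0 <= a -> sqnorm (a *: x) = a ^+ 2 * sqnorm x.
Proof.
move=> a0; rewrite /sqnorm adjmxZ//.
by rewrite -scalemxAl -scalemxAr scalerA mxE expr2.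
Qed.

Lemma sqnorm_mulmx (C : numClosedFieldType) (n : nat) (A : 'M[C]_n)
    (x : 'cV[C]_n) : sqnorm (A *m x) = (x ^t* *m (A ^t* *m A) *m x) 0 0.
Proof. by rewrite /sqnorm trmx_mul map_mxM !mulmxA. Qed.

Lemma cholesky_unitmx (C : numClosedFieldType) (n : nat) (B R : 'M[C]_n) :
  cholesky_factor B R -> R \in unitmx.
Proof.
case=> trigR diagR _; rewrite -unitmx_tr unitmxE det_trig// unitfE.
by apply/prodf_neq0 => i _; rewrite mxE gt_eqF.
Qed.

Lemma gram_hermitian (C : numClosedFieldType) (n : nat) (R : 'M[C]_n) :
  (R ^t* *m R) ^t* = R ^t* *m R.
Proof. by rewrite trmx_mul map_mxM trmxCK. Qed.

Lemma posdefmx_sqnorm_lt (C : numClosedFieldType) (n : nat) (A B : 'M[C]_n)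
    (t : C) (x : 'cV[C]_n) :
    B ^t* = B -> posdefmx (A ^t* *m A - t *: B ^+ 2) -> x != 0 ->
  t * sqnorm (B *m x) < sqnorm (A *m x).
Proof.
move=> hB [_ pos] /pos; rewrite !sqnorm_mulmx hB mulmxBr mulmxBl.
by rewrite -scalemxAr -scalemxAl !mxE subr_gt0.
Qed.

(** The vectors [y] and [w] turn the eigenvalue equation of the Gram matrix
    into a pair of relations between [A], [A^H] and [B] alone, to which each
    definiteness hypothesis applies once.  Being nonnegative, [a] is comparable
    with [theta], so that the inequality can be proved by contradiction. *)
Lemma eigenvalue_gram_gt (C : numClosedFieldType) (n : nat)
    (A B R M : 'M[C]_n) (theta a : C) :
    R \in unitmx -> B = R ^t* *m R -> A = R ^t* *m M *m R -> 0 < theta ->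
    posdefmx (A ^t* *m A - theta *: B ^+ 2) ->
    posdefmx (A *m A ^t* - theta *: B ^+ 2) ->
  eigenvalue (M ^t* *m M) a -> theta < a.
Proof.
move=> uR BE AE t0 posAhA posAAh ea.
have a0 := eigenvalue_gram_ge0 ea.
have hB : B ^t* = B by rewrite BE gram_hermitian.
have [v vM v0] := eigenvalueP ea.
(* Eigenvectors are rows; the Gram matrix being Hermitian and [a] real, the
   conjugate transpose is a column eigenvector. *)
pose u : 'cV[C]_n := v ^t*.
have Mu : M ^t* *m M *m u = a *: u.
  rewrite /u -{1}gram_hermitian -map_mxM -trmx_mul vM.
  by rewrite adjmxZ.
pose y := invmx R *m u; pose w := invmx R *m (M *m u).
have Ry : R *m y = u by rewrite mulKVmx.
have Rw : R *m w = M *m u by rewrite mulKVmx.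
have Ay : A *m y = B *m w by rewrite AE BE -!mulmxA Ry Rw.
have Aw : A ^t* *m w = a *: (B *m y).
  rewrite AE BE !trmx_mul !map_mxM trmxCK -!mulmxA Rw Ry (mulmxA _ M) Mu.
  by rewrite scalemxAr.
have y0 : y != 0.
  apply: contraNneq v0 => y0; rewrite -[v]trmxCK -/u -Ry y0 mulmx0.
  by rewrite trmx0 map_mx0.
have lt1 : theta * sqnorm (B *m y) < sqnorm (B *m w).
  by rewrite -Ay; exact: posdefmx_sqnorm_lt.
have le2 : theta * sqnorm (B *m w) <= a ^+ 2 * sqnorm (B *m y).
  rewrite -sqnormZ// -Aw; have [->|w0] := eqVneq w 0.
    by rewrite !mulmx0 sqnorm0 mulr0.
  by apply/ltW/posdefmx_sqnorm_lt => //; rewrite trmxCK.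
rewrite (real_ltNge (gtr0_real t0) (ger0_real a0)); apply/negP => a_le.
have : theta ^+ 2 * sqnorm (B *m y) < a ^+ 2 * sqnorm (B *m y).
  by apply: lt_le_trans le2; rewrite expr2 -mulrA ltr_pM2l.
by apply/negP; rewrite le_gtF// ler_wpM2r ?sqnorm_ge0// lerXn2r// nnegrE ltW.
Qed.

Theorem theorem2 (K : realType) (n : nat) (A B R : 'M[K[i]]_n) (theta : K)
    (n_gt0 : (0 < n)%N)
    (posB : posdefmx B)
    (cholR : cholesky_factor B R)
    (theta_gt0 : 0 < theta)
    (posAhA : posdefmx (A ^t* *m A - theta%:C *: B ^+ 2))
    (posAAh : posdefmx (A *m A ^t* - theta%:C *: B ^+ 2)) :
  Num.sqrt theta <= sigma_min (invmx (R ^t*) *m A *m invmx R).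
Proof.
have uR := cholesky_unitmx cholR.
have [_ _ BE] := cholR.
set M := _ *m _ *m _.
have [/andP[s0 es] _] := sigma_minP M n_gt0.
have AE : A = R ^t* *m M *m R.
  by rewrite /M -!mulmxA mulVmx// mulmx1 mulKVmx// map_unitmx unitmx_tr.
have t0 : 0 < theta%:C by rewrite ltcR.
have := eigenvalue_gram_gt uR BE AE t0 posAhA posAAh es.
by rewrite ltcR => /ltW/ler_wsqrtr; rewrite sqrtr_sqr ger0_norm.
Qed.
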